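(* Let $K$ be a field, $X$ a $K$-valued vertex-weighted finite graph, $G$ a finite group, $\alpha\colon\mathbb{E}(X)\to G$ a voltage assignment, and $H\le G$ a subgroup. Fix a full set of representatives $\sigma_1,\dots,\sigma_m$ of the right cosets $H\backslash G$. Let $Z$ be the graph with $V(Z)=V(X)\times H\backslash G$, $\mathbb{E}(Z)=\mathbb{E}(X)\times H\backslash G$, $o(e,H\sigma)=(o(e),H\sigma)$, $t(e,H\sigma)=(t(e),H\sigma\alpha(e))$, $\overline{(e,H\sigma)}=(\bar e,H\sigma\alpha(e))$, weights $w_{(v,H\sigma)}=w_v$ and $\sqrt{w_{(v,H\sigma)}}=\sqrt{w_v}$, and let $\beta\colon\mathbb{E}(Z)\to H$ be given by $\beta(e,H\sigma_i)=\sigma_i\alpha(e)\sigma_j^{-1}$ where $j$ is the unique index with $H\sigma_i\alpha(e)=H\sigma_j$. Then for every finite-dimensional representation $\rho$ of $H$ over $\bar K$, \[ h_Z^{\beta}(\rho,t)=h_X^{\alpha}\bigl(\operatorname{Ind}_H^G\rho,t\bigr). \]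
   Context: A graph $X$: finite sets $V(X)$, $\mathbb{E}(X)$, maps $o,t$, involution $e\mapsto\bar e$ with $\bar e\ne e$, $o(\bar e)=t(e)$; loops, multi-edges allowed. Weights $w\colon V(X)\to K$, square roots $\sqrt{w_v}$ in an algebraic closure $\bar K$. $\bm{D}_X$ diagonal with $\bm{D}_X(u,u)=\sum_{e:o(e)=u}w_{t(e)}$. A voltage assignment $\alpha\colon\mathbb{E}(X)\to G$ satisfies $\alpha(\bar e)=\alpha(e)^{-1}$ ($\beta$ above is one). $\mathcal{W}_X^{\alpha,\sigma}(u,v)=\sum_{e:\alpha(e)=\sigma,o(e)=u,t(e)=v}\sqrt{w_u}\sqrt{w_v}$. For a representation $\rho$ of $G$ of degree $d_\rho$ given by matrices $\rho(\sigma)$, \[ h_X^{\alpha}(\rho,t)=\det\Bigl(\bm{I}_{V(X)}\otimes\bm{I}_{d_\rho}-t\sum_{\sigma\in G}\mathcal{W}_X^{\alpha,\sigma}\otimes\rho(\sigma)+t^2(\bm{D}_X-\bm{I}_{V(X)})\otimes\bm{I}_{d_\rho}\Bigr), \] and analogously for $Z$, $\beta$, $H$. $\operatorname{Ind}_H^G\rho$ is the induced representation. *)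

(* Defs.v *)
From HB Require Import structures.
From mathcomp Require Import all_boot all_order all_algebra all_fingroup.
From mathcomp Require Import all_solvable all_field all_character.
From mathcomp Require Export mxtens.

Set Implicit Arguments.
Unset Strict Implicit.
Unset Printing Implicit Defensive.

Import GRing.Theory.
Local Open Scope ring_scope.

(* Finite graphs with loops and multi-edges; [edge] is the set of oriented    *)
(* edges, and t (bar e) = o e follows from [org_inv] and [einvK].             *)
Record graph := Graph {
  vertex : finType;
  edge : finType;
  org : edge -> vertex;
  tgt : edge -> vertex;
  einv : edge -> edge;
  einvK : involutive einv;
  einv_neq : forall e, einv e != e;
  org_inv : forall e, org (einv e) = tgt e
}.

Section Weighted.

Variables (K F : fieldType) (iota : {rmorphism K -> F}).

(* A K-valued weight together with a choice in F of square roots of it.       *)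
Record wgraph := WGraph {
  wg_graph :> graph;
  wt : vertex wg_graph -> K;
  sqrtw : vertex wg_graph -> F;
  sqrtwK : forall v, sqrtw v ^+ 2 = iota (wt v)
}.

Record voltage (X : graph) (gT : finGroupType) (G : {group gT}) := Voltage {
  volt :> edge X -> gT;
  voltG : forall e, volt e \in G;
  voltV : forall e, volt (einv e) = ((volt e)^-1)%g
}.

Section Zeta.

Variables (X : wgraph) (gT : finGroupType) (G : {group gT}).
Variable alpha : voltage X G.

(* Vertices index matrices through the enumeration of [vertex X].             *)
Local Notation nV := #|{: vertex X}|.

Definition valency_mx : 'M[F]_nV :=
  \matrix_(i, j) ((\sum_(e | org e == enum_val i) iota (wt (tgt e))) *+ (i == j)).

Definition weight_mx (s : gT) : 'M[F]_nV :=
  \matrix_(i, j)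
    \sum_(e | [&& alpha e == s, org e == enum_val i & tgt e == enum_val j])
      sqrtw (enum_val i) * sqrtw (enum_val j).

Definition hpoly d (rho : mx_representation F G d) : {poly F} :=
  \det (map_mx polyC (1%:M *t 1%:M)
        - 'X *: map_mx polyC (\sum_(s in G) weight_mx s *t rho s)
        + 'X^2 *: map_mx polyC ((valency_mx - 1%:M) *t 1%:M)
        : 'M[{poly F}]_(nV * d)).

End Zeta.

Section Derived.

Variables (X : wgraph) (gT : finGroupType) (G H : {group gT}).
Variable alpha : voltage X G.

Definition rcoset_type := {C : {set gT} | C \in rcosets H G}.

Lemma shift_subproof (e : edge X) (C : rcoset_type) :
  (val C :* alpha e)%g \in rcosets H G.
Proof.
case: C => _ /= /rcosetsP[x Gx ->]; rewrite -rcosetM.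
by apply/rcosetsP; exists (x * alpha e)%g; rewrite ?groupM ?voltG.
Qed.

Definition coset_shift e C : rcoset_type :=
  exist (fun D => D \in rcosets H G) _ (shift_subproof e C).

Local Notation vtx := (vertex X * rcoset_type)%type.
Local Notation edg := (edge X * rcoset_type)%type.

Definition derived_inv (eC : edg) : edg := (einv eC.1, coset_shift eC.1 eC.2).
Definition derived_org (eC : edg) : vtx := (org eC.1, eC.2).
Definition derived_tgt (eC : edg) : vtx := (tgt eC.1, coset_shift eC.1 eC.2).

Lemma derived_invK : involutive derived_inv.
Proof.
case=> e C; rewrite /derived_inv /= einvK; congr (_, _); apply: val_inj => /=.
by rewrite voltV rcosetK.
Qed.

Lemma derived_inv_neq eC : derived_inv eC != eC.
Proof. by case: eC => e C; rewrite xpair_eqE (negPf (einv_neq e)). Qed.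

Lemma derived_org_inv eC : derived_org (derived_inv eC) = derived_tgt eC.
Proof. by rewrite /derived_org /derived_tgt /= org_inv. Qed.

Definition derived_graph : graph :=
  @Graph vtx edg derived_org derived_tgt derived_inv
    derived_invK derived_inv_neq derived_org_inv.

Definition derived_wgraph : wgraph :=
  @WGraph derived_graph (fun v => wt v.1) (fun v => sqrtw v.1)
    (fun v => sqrtwK v.1).

End Derived.

End Weighted.

Record rcoset_reps (gT : finGroupType) (G H : {group gT}) (m : nat) :=
  RcosetReps {
    rep :> 'I_m -> gT;
    repG : forall i, rep i \in G;
    rep_inj : injective (fun i => (H :* rep i)%g);
    rep_surj : forall C, C \in rcosets H G -> exists i, C == (H :* rep i)%g
  }.

Section DerivedVoltage.

Variables (K F : fieldType) (iota : {rmorphism K -> F}) (X : wgraph iota).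
Variables (gT : finGroupType) (G H : {group gT}) (alpha : voltage X G).
Variables (m : nat) (sigma : rcoset_reps G H m).

Definition rep_idx (C : rcoset_type G H) : 'I_m :=
  xchoose (rep_surj sigma (valP C)).

Lemma rep_idxE C : val C = (H :* sigma (rep_idx C))%g.
Proof. exact/eqP/(xchooseP (rep_surj sigma (valP C))). Qed.

Definition derived_volt (eC : edge (derived_wgraph H alpha)) : gT :=
  (sigma (rep_idx eC.2) * alpha eC.1
    * (sigma (rep_idx (coset_shift alpha eC.1 eC.2)))^-1)%g.

Lemma derived_voltH eC : derived_volt eC \in H.
Proof.
case: eC => e C; rewrite /derived_volt /= -mem_rcoset -rep_idxE /= rep_idxE.
by rewrite -rcosetM rcoset_refl.
Qed.

Lemma derived_voltV eC : derived_volt (einv eC) = ((derived_volt eC)^-1)%g.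
Proof.
case: eC => e C; rewrite /derived_volt /=.
have -> : coset_shift alpha (einv e) (coset_shift alpha e C) = C.
  by apply: val_inj; rewrite /= voltV rcosetK.
by rewrite voltV !invMg invgK mulgA.
Qed.

Definition derived_voltage : voltage (derived_wgraph H alpha) H :=
  Voltage derived_voltH derived_voltV.

(* The defining formula, for the representatives of the cosets involved.      *)
Lemma derived_voltageE (e : edge X) (C : rcoset_type G H) i j :
  val C = (H :* sigma i)%g -> (H :* sigma i :* alpha e = H :* sigma j)%g ->
  derived_voltage (e, C) = (sigma i * alpha e * (sigma j)^-1)%g.
Proof.
move=> defC defCe; rewrite /= /derived_volt /=.
have /rep_inj <- : (H :* sigma (rep_idx C) = H :* sigma i)%g.
  by rewrite -rep_idxE.
suff /rep_inj -> : (H :* sigma (rep_idx (coset_shift alpha e C)) =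
                    H :* sigma j)%g by [].
by rewrite -rep_idxE /= defC.
Qed.

End DerivedVoltage.

(* Induced representation. Matrix representations act on row vectors from the *)
(* right, so the module of rho is a right F[H]-module W = 'rV_d, and the      *)
(* induced module is W (x)_F[H] F[G], i.e. the quotient of W (x)_F F[G] by    *)
(* the span of all w h (x) g - w (x) h g. The matrices thus obtained are, up  *)
(* to similarity, those that F[G] (x)_F[H] W' yields for the left module      *)
(* W' = 'cV_d defined by the same matrices rho(h).                            *)
Section Induced.

Variables (F : fieldType) (gT : finGroupType) (G H : {group gT}).
Hypothesis sHG : H \subset G.
Variables (d : nat) (rho : mx_representation F H d).

(* W (x)_F F[G], with G acting by right multiplication on F[G].               *)
Definition free_ind_mx (x : gT) : 'M[F]_(d * #|G|) :=
  1%:M *t regular_repr F G x.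

Lemma free_ind_mx_repr : mx_repr G free_ind_mx.
Proof.
split=> [|x y Gx Gy]; rewrite /free_ind_mx.
  rewrite repr_mx1; apply/matrixP=> i j.
  case: (mxtens_indexP i) => i0 i1; case: (mxtens_indexP j) => j0 j1.
  by rewrite tensmxE !mxE (can_eq (@mxtens_indexK _ _)) xpair_eqE -natrM mulnb.
by rewrite tensmx_mul mulmx1 repr_mxM.
Qed.
Canonical free_ind_repr := MxRepresentation free_ind_mx_repr.

Definition gbasis (g : gT) : 'rV[F]_#|G| := delta_mx 0 (gring_index G g).

(* The rows are w h (x) g - w (x) h g for w in the standard basis of W.       *)
Definition balance_mx (h g : gT) : 'M[F]_(d * 1, d * #|G|) :=
  rho h *t gbasis g - 1%:M *t gbasis (h * g).

Definition balance_space : 'M[F]_(d * #|G|) :=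
  (\sum_(h in H) \sum_(g in G) <<balance_mx h g>>)%MS.

Lemma gbasisM g x :
  g \in G -> gbasis g *m regular_repr F G x = gbasis (g * x).
Proof. by move=> Gg; rewrite /gbasis -rowE rowK gring_indexK. Qed.

Lemma balance_module : mxmodule free_ind_repr balance_space.
Proof.
apply/mxmoduleP=> x Gx; rewrite /balance_space sumsmxMr.
apply/sumsmx_subP=> h Hh; rewrite sumsmxMr; apply/sumsmx_subP=> g Gg.
have Gh := subsetP sHG h Hh.
apply: (sumsmx_sup h) => //; apply: (sumsmx_sup (g * x)%g); first exact: groupM.
rewrite (eqmxMr _ (genmxE _)) genmxE /balance_mx /= /free_ind_mx.
by rewrite mulmxBl !tensmx_mul !mulmx1 !gbasisM ?groupM // mulgA submx_refl.
Qed.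

Definition ind_repr := factmod_repr balance_module.

End Induced.

(* Main.v *)
Require Import Defs.
From mathcomp Require Import all_boot all_order all_algebra all_fingroup.
From mathcomp Require Import all_solvable all_field all_character.

Set Implicit Arguments.
Unset Strict Implicit.
Unset Printing Implicit Defensive.

(* The induced module has the explicit model 'rV_d (x) 'rV_m, in which
   w (x) e_i stands for w (x) sigma_i; there the (i, j) block of x in G is
   rho (sigma_i x sigma_j^-1) when sigma_i x sigma_j^-1 lies in H, that is when
   H sigma_i x = H sigma_j, and 0 otherwise. For x = alpha e this condition
   says that the lift of e starting over H sigma_i ends over H sigma_j, and the
   block is then rho of the derived voltage of that lift. So, once the indices
   ((v, H sigma_i), a) and (v, (a, i)) are identified, the two matrices whose
   determinants are compared are equal entry by entry. *)

Import GRing.Theory.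
Local Open Scope ring_scope.

(** * Kronecker products, and determinants under reindexing *)

Lemma tensmx1 (R : comPzRingType) m n :
  (1%:M : 'M[R]_m) *t (1%:M : 'M[R]_n) = 1%:M.
Proof.
apply/matrixP=> i j.
case: (mxtens_indexP i) => i0 i1; case: (mxtens_indexP j) => j0 j1.
by rewrite tensmxE !mxE (can_eq (@mxtens_indexK _ _)) xpair_eqE -natrM mulnb.
Qed.

Lemma tensmx_sumr (R : comPzRingType) m n p q (A : 'M[R]_(m, n))
    (I : finType) (P : pred I) (B : I -> 'M[R]_(p, q)) :
  A *t (\sum_(i | P i) B i) = \sum_(i | P i) A *t B i.
Proof.
apply/matrixP=> i j; rewrite !mxE summxE mulr_sumr summxE.
by apply: eq_bigr => k _; rewrite !mxE.
Qed.

(** A bijection forces [p = q], so [f] permutes rows and columns alike and its sign enters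
    squared. *)
Lemma det_mxsub_bij (R : comPzRingType) p q (f : 'I_p -> 'I_q) (A : 'M[R]_q) :
  bijective f -> \det (mxsub f f A) = \det A.
Proof.
move=> bij_f; have := bij_eq_card bij_f; rewrite !card_ord => eq_pq.
case: q / eq_pq in f A bij_f *; pose s := perm (bij_inj bij_f).
have -> : mxsub f f A = row_perm s (col_perm s A).
  by apply/matrixP=> i j; rewrite !mxE !permE.
rewrite row_permE col_permE !det_mulmx !det_perm odd_permV mulrC -mulrA.
by rewrite -expr2 sqrr_sign mulr1.
Qed.

(** * Unique factorisation of elements of [G] over the coset representatives *)

Section RcosetReps.

Variables (gT : finGroupType) (G H : {group gT}) (sHG : H \subset G).
Variables (m : nat) (sigma : rcoset_reps G H m).

Lemma rep_decomp g :
  g \in G -> exists i, exists2 h, h \in H & g = (h * sigma i)%g.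
Proof.
move=> Gg; have [|i /eqP defHg] := @rep_surj _ _ _ _ sigma (H :* g)%g.
  by apply/rcosetsP; exists g.
have /rcosetP[h Hh ->] : g \in (H :* sigma i)%g by rewrite -defHg rcoset_refl.
by exists i, h.
Qed.

Lemma rcosetM_id h x : h \in H -> (H :* (h * x) = H :* x)%g.
Proof. by move=> Hh; rewrite rcosetM rcoset_id. Qed.

Lemma rep_decomp_inj h k i j :
    h \in H -> k \in H -> (h * sigma i = k * sigma j)%g ->
  h = k /\ i = j.
Proof.
move=> Hh Hk eq_hk; suff eq_ij : i = j.
  by split=> //; move: eq_hk; rewrite eq_ij => /mulIg.
apply: (rep_inj (r := sigma)).
by rewrite -[LHS](rcosetM_id _ Hh) eq_hk rcosetM_id.
Qed.

(** * The explicit model of the induced module *)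

Section InducedModel.

Variables (F : fieldType) (d : nat) (rho : mx_representation F H d).

Local Notation free := (free_ind_repr F G d).
Local Notation U := (balance_space G rho).

(* w (x) e_i |-> w (x) sigma_i *)
Definition ind_lift_mx : 'M[F]_(d * m, d * #|G|) :=
  \sum_i 1%:M *t (delta_mx i 0 *m gbasis F G (sigma i)).

(* w (x) h sigma_i |-> w h (x) e_i *)
Definition ind_eval_mx : 'M[F]_(d * #|G|, d * m) :=
  \sum_(h in H) \sum_i
     rho h *t delta_mx (gring_index G (h * sigma i)) i.

(** By uniqueness of the factorisation [h * sigma i], a single summand of [ind_eval_mx] survives. *)
Lemma gbasis_eval k (M : 'M_(k, d)) (h : gT) i : h \in H ->
  (M *t gbasis F G (h * sigma i)) *m ind_eval_mx
    = (M *m rho h) *t delta_mx 0 i.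
Proof.
move=> Hh; rewrite /ind_eval_mx mulmx_sumr (bigD1 h) //= mulmx_sumr (bigD1 i) //=.
have gringE l j :
    l \in H -> gring_index G (h * sigma i) = gring_index G (l * sigma j) ->
  h = l /\ i = j.
  move=> Hl /(congr1 enum_val).
  (* [gring_index] takes a default value outside [G], so both products must first be placed in
     [G]. *)
  rewrite !gring_indexK ?groupM ?repG ?(subsetP sHG) //.
  exact: rep_decomp_inj.
rewrite tensmx_mul mul_delta_mx !big1 ?addr0 //.
  move=> l /andP[Hl neq_lh]; rewrite mulmx_sumr big1 // => j _.
  rewrite tensmx_mul mul_delta_mx_cond.
  case: eqP => [/gringE[]// eq_hl|].
    by rewrite eq_hl eqxx in neq_lh.
  by rewrite mulr0n tensmx0.
move=> j neq_ji; rewrite tensmx_mul mul_delta_mx_cond.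
case: eqP => [/gringE[]// _ eq_ij|].
  by rewrite eq_ij eqxx in neq_ji.
by rewrite mulr0n tensmx0.
Qed.

Lemma lift_free_eval x : x \in G ->
  ind_lift_mx *m free x *m ind_eval_mx
    = \sum_i ((1%:M : 'M_d) *t delta_mx i 0)
        *m ((1%:M *t gbasis F G (sigma i * x)) *m ind_eval_mx).
Proof.
move=> Gx; rewrite /ind_lift_mx !mulmx_suml; apply: eq_bigr => i _.
rewrite mulmxA /= /free_ind_mx !tensmx_mul !mul1mx -[delta_mx _ _ *m _ *m _]mulmxA.
by rewrite gbasisM ?repG.
Qed.

Lemma lift_eval : ind_lift_mx *m ind_eval_mx = 1%:M.
Proof.
have := lift_free_eval (group1 G); rewrite repr_mx1 mulmx1 => ->.
rewrite -tensmx1 (mx1_sum_delta _ m) tensmx_sumr; apply: eq_bigr => i _.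
rewrite mulg1 -[sigma i]mul1g gbasis_eval // repr_mx1 mulmx1.
by rewrite tensmx_mul mul1mx mul_delta_mx.
Qed.

(** For g = k sigma_i, both w h (x) g and w (x) h g evaluate to w h k (x) e_i, so evaluation
    descends to the quotient. *)
Lemma balance_eval : U *m ind_eval_mx = 0.
Proof.
apply/sub_kermxP/sumsmx_subP=> h Hh; apply/sumsmx_subP=> g Gg.
rewrite genmxE; apply/sub_kermxP.
have [i [k Hk ->]] := rep_decomp Gg; rewrite /balance_mx mulmxBl mulgA.
by rewrite !gbasis_eval ?groupM // mul1mx repr_mxM // subrr.
Qed.

Lemma delta_lift k (M : 'M_(k, d)) i :
  (M *t delta_mx 0 i) *m ind_lift_mx = M *t gbasis F G (sigma i).
Proof.
rewrite /ind_lift_mx mulmx_sumr (bigD1 i) //= tensmx_mul mulmx1 mulmxA.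
rewrite mul_delta_mx big1 ?addr0 => [|j neq_ji].
  by rewrite (mx11_scalar (delta_mx 0 0)) mxE !eqxx mul1mx.
by rewrite tensmx_mul mulmxA mul_delta_mx_0 1?eq_sym // mul0mx tensmx0.
Qed.

(** Evaluating and lifting turns w (x) h sigma_i into w h (x) sigma_i; the difference is, up to
    sign, the balancing relation for h and sigma_i. *)
Lemma eval_lift_sub : (1%:M - ind_eval_mx *m ind_lift_mx <= U)%MS.
Proof.
rewrite -[_ *m _]mul1mx -(tensmx1 _ d) (mx1_sum_delta _ #|G|) tensmx_sumr mulmx_suml.
rewrite -sumrB; apply: summx_sub => b _.
have [i [h Hh def_b]] := rep_decomp (enum_valP b).
have -> : delta_mx b b = delta_mx b 0 *m gbasis F G (h * sigma i).
  by rewrite /gbasis -def_b gring_valK mul_delta_mx.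
rewrite -[1%:M in X in (X <= _)%MS]mulmx1 -tensmx_mul -mulmxA -mulmxBr.
apply: mulmx_sub; rewrite mulmxA gbasis_eval // mul1mx delta_lift.
rewrite -opprB eqmx_opp /balance_space.
apply: (sumsmx_sup h) => //; apply: (sumsmx_sup (sigma i)); first exact: repG.
by rewrite genmxE.
Qed.

Definition ind_mx (x : gT) : 'M[F]_(d * m) :=
  ind_lift_mx *m free x *m ind_eval_mx.

Lemma balance_sub_eval k (A : 'M_(k, d * #|G|)) :
  (A <= U)%MS -> A *m ind_eval_mx = 0.
Proof. by case/submxP=> B ->; rewrite -mulmxA balance_eval mulmx0. Qed.

(** Lifting is equivariant only modulo [U], but [U] is [G]-stable and killed by evaluation, so
    evaluation is truly equivariant. *)
Lemma free_eval x : x \in G ->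
  free x *m ind_eval_mx = ind_eval_mx *m ind_mx x.
Proof.
move=> Gx; apply/eqP; rewrite -subr_eq0 /ind_mx 2!mulmxA -mulmxBl.
rewrite -[free x in X in X - _]mul1mx -mulmxBl; apply/eqP/balance_sub_eval.
apply: submx_trans (submxMr _ eval_lift_sub) _.
exact: (mxmoduleP (balance_module sHG rho)).
Qed.

Lemma ind_mx_repr : mx_repr G ind_mx.
Proof.
split=> [|x y Gx Gy]; first by rewrite /ind_mx repr_mx1 mulmx1 lift_eval.
by rewrite {1}/ind_mx repr_mxM // -!mulmxA free_eval // !mulmxA.
Qed.
Canonical ind_mx_representation := MxRepresentation ind_mx_repr.

Lemma ind_mx_rsim : mx_rsim ind_mx_representation (ind_repr sHG rho).
Proof.
pose B := in_factmod U ind_lift_mx.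
(* Modulo [U] every vector equals the lift of its evaluation, so the projection factors through the
   model. *)
have BE k (A : 'M_(k, d * #|G|)) : in_factmod U A = A *m ind_eval_mx *m B.
  apply/eqP; rewrite /B [in_factmod U ind_lift_mx]in_factmodE mulmxA.
  rewrite -in_factmodE.
  rewrite -subr_eq0 -linearB /= in_factmod_eq0 -mulmxA -{1}[A]mulmx1 -mulmxBr.
  exact: mulmx_sub eval_lift_sub.
have fullB : row_full B.
  apply/row_fullP; exists (val_factmod 1%:M *m ind_eval_mx).
  by rewrite -BE val_factmodK.
(* If the lift of [u] lies in [U], evaluation kills it; yet evaluating that lift returns [u]. *)
have freeB : row_free B.
  apply/inj_row_free=> u uB0; rewrite -[u]mulmx1 -lift_eval mulmxA.
  apply: balance_sub_eval; rewrite -in_factmod_eq0 in_factmodE -mulmxA.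
  by rewrite -in_factmodE uB0.
exists B => //; first by rewrite -(eqP freeB) (eqP fullB).
by move=> x Gx; rewrite /B -in_factmodJ // -BE.
Qed.

(** Writing sigma_i x = h sigma_k, the only nonzero block in block row i is rho(h), in block column
    k. *)
Lemma ind_mxE x a i b j : x \in G ->
  ind_mx x (mxtens_index (a, i)) (mxtens_index (b, j))
    = if (sigma i * x * (sigma j)^-1)%g \in H
      then rho (sigma i * x * (sigma j)^-1)%g a b else 0.
Proof.
move=> Gx; rewrite /ind_mx lift_free_eval // summxE (bigD1 i) //= big1 ?addr0.
  have [k [h Hh ->]] := rep_decomp (groupM (repG sigma i) Gx).
  rewrite gbasis_eval // mul1mx tensmx_mul mul1mx mul_delta_mx tensmxE mxE eqxx /=.
  case: (eqVneq j k) => [->|neq_jk]; first by rewrite mulgK Hh mulr1.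
  rewrite mulr0; case: ifP => // Hhk; case/eqP: neq_jk.
  (* Membership in [H] would give a second factorisation, over sigma_j, forcing j = k. *)
  by have [] := rep_decomp_inj Hh Hhk (esym (mulgKV _ _)).
move=> k neq_ki; have [l [h Hh ->]] := rep_decomp (groupM (repG sigma k) Gx).
rewrite gbasis_eval // mul1mx tensmx_mul mul1mx mul_delta_mx tensmxE mxE.
by rewrite eq_sym (negPf neq_ki) mulr0.
Qed.

End InducedModel.
End RcosetReps.

(** * The matrix defining [hpoly]: similarity invariance and entries *)

Section ZetaMatrix.

Variables (K F : fieldType) (iota : {rmorphism K -> F}) (X : wgraph iota).
Variables (gT : finGroupType) (G : {group gT}) (alpha : voltage X G).

Local Notation nV := #|{: vertex X}|.

(** Conjugation by 1 (x) B fixes the identity and valency terms and carries [tau1] to [tau2]; its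
    nonzero determinant cancels in the domain of polynomials. *)
Lemma hpoly_rsim n1 n2 (tau1 : mx_representation F G n1)
    (tau2 : mx_representation F G n2) :
  mx_rsim tau1 tau2 -> hpoly alpha tau1 = hpoly alpha tau2.
Proof.
case=> B eq_n; case: n2 / eq_n in tau2 B *; rewrite row_free_unit => uB homB.
pose S := map_mx polyC ((1%:M : 'M_nV) *t B).
have nzS : \det S != 0.
  apply/eqP=> dS0; have : \det (S *m map_mx polyC (1%:M *t invmx B)) = 1.
    by rewrite -map_mxM tensmx_mul mulmx1 mulmxV // tensmx1 map_mx1 det1.
  by rewrite det_mulmx dS0 mul0r => /esym/eqP; rewrite oner_eq0.
apply: (mulfI nzS); rewrite mulrC -!det_mulmx; congr (\det _).
rewrite !(mulmxDl, mulmxDr, mulNmx, mulmxN) -!scalemxAl -!scalemxAr -!map_mxM.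
rewrite !tensmx_mul !mulmx1 !mul1mx mulmx_suml mulmx_sumr.
congr (_ - 'X *: map_mx _ _ + _); apply: eq_bigr => s Gs.
by rewrite !tensmx_mul mulmx1 mul1mx homB.
Qed.

Variables (d : nat) (rho : mx_representation F G d).

(** Each edge occurs for exactly one s, its own voltage, so the double sum collapses. *)
Lemma voltage_sumE (i j : 'I_nV) (a b : 'I_d) :
  (\sum_(s in G) weight_mx alpha s *t rho s)
      (mxtens_index (i, a)) (mxtens_index (j, b))
    = \sum_(e | (org e == enum_val i) && (tgt e == enum_val j))
        sqrtw (enum_val i) * sqrtw (enum_val j) * rho (alpha e) a b.
Proof.
rewrite summxE [RHS](partition_big alpha (mem G)) => [|e _]; last exact: voltG.
apply: eq_bigr => s _; rewrite tensmxE mxE mulr_suml.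
by apply: eq_big => [e|e /andP[/eqP-> _]//]; rewrite [RHS]andbC.
Qed.

Lemma valency_tensE (i j : 'I_nV) (a b : 'I_d) :
  ((valency_mx X - 1%:M) *t 1%:M) (mxtens_index (i, a)) (mxtens_index (j, b))
    = (\sum_(e | org e == enum_val i) iota (wt (tgt e)) - 1)
        *+ (mxtens_index (i, a) == mxtens_index (j, b)).
Proof.
rewrite tensmxE !mxE (can_eq (@mxtens_indexK _ _)) xpair_eqE.
by case: eqP => _; case: eqP => _; rewrite ?mulr1 ?mulr0 ?subr0 ?mul0r ?mulr1n.
Qed.

End ZetaMatrix.

(** * Comparison of the derived graph with the base graph *)

Section DerivedGraph.

Variables (K F : fieldType) (iota : {rmorphism K -> F}) (X : wgraph iota).
Variables (gT : finGroupType) (G H : {group gT}) (sHG : H \subset G).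
Variables (alpha : voltage X G) (m : nat) (sigma : rcoset_reps G H m).
Variables (d : nat) (rho : mx_representation F H d).

Local Notation Z := (derived_wgraph H alpha).
Local Notation beta := (derived_voltage alpha sigma).
Local Notation nX := #|{: vertex X}|.
Local Notation nZ := #|{: vertex Z}|.

Lemma rep_idx_bij : bijective (rep_idx sigma : rcoset_type G H -> 'I_m).
Proof.
have cosetP i : (H :* sigma i)%g \in rcosets H G.
  by apply/rcosetsP; exists (sigma i); rewrite ?repG.
exists (fun i => exist (fun D => D \in rcosets H G) _ (cosetP i)) => [C|i].
  by apply: val_inj; rewrite /= -rep_idxE.
by apply: (rep_inj (r := sigma)); rewrite -rep_idxE.
Qed.

Definition derived_index (k : 'I_(nZ * d)) : 'I_(nX * (d * m)) :=
  let v := enum_val (mxtens_unindex k).1 in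
  mxtens_index (enum_rank v.1,
                mxtens_index ((mxtens_unindex k).2, rep_idx sigma v.2)).

Lemma derived_indexE p a :
  derived_index (mxtens_index (p, a))
    = mxtens_index (enum_rank (enum_val p).1,
                    mxtens_index (a, rep_idx sigma (enum_val p).2)).
Proof. by rewrite /derived_index mxtens_indexK. Qed.

Lemma derived_index_bij : bijective derived_index.
Proof.
have [coset_idx idxK cosetK] := rep_idx_bij.
exists (fun k => mxtens_index
  (enum_rank ((enum_val (mxtens_unindex k).1,
               coset_idx (mxtens_unindex (mxtens_unindex k).2).2) : vertex Z),
   (mxtens_unindex (mxtens_unindex k).2).1)) => k.
  case: (mxtens_indexP k) => p a; rewrite derived_indexE !mxtens_indexK idxK.
  congr (mxtens_index (_, a)); apply: enum_val_inj; rewrite !enum_rankK.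
  by case: (enum_val p).
case: (mxtens_indexP k) => q r; case: (mxtens_indexP r) => a i.
by rewrite derived_indexE !mxtens_indexK enum_rankK cosetK enum_valK.
Qed.

(** This matches the incidence condition in [Z] with the nonvanishing condition of [ind_mxE]. *)
Lemma coset_shift_eq e (C D : rcoset_type G H) :
  (coset_shift alpha e C == D)
    = (sigma (rep_idx sigma C) * alpha e
         * (sigma (rep_idx sigma D))^-1 \in H)%g.
Proof.
rewrite -mem_rcoset -rep_idxE -val_eqE /= [in LHS](rep_idxE sigma C) -rcosetM.
rewrite [val D](rep_idxE sigma D); apply/eqP/idP => [<-|/rcoset_eqP//].
exact: rcoset_refl.
Qed.

(** Edges of [Z] leaving (u, C) carry the coset [C], so they are determined by their projection to
    [X]. *)
Lemma big_derived_edges (P : pred (edge Z)) u C (f : edge Z -> F) :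
  (forall eC, P eC -> org eC = (u, C)) ->
  \sum_(eC | P eC) f eC = \sum_(e | P (e, C)) f (e, C).
Proof.
move=> PuC.
rewrite (reindex_onto (fun e => (e, C)) fst) => [|[e E] /PuC [_ <-]//].
by apply: eq_bigl => e; rewrite eqxx andbT.
Qed.

Lemma voltage_sum_derived (k l : 'I_(nZ * d)) :
  (\sum_(h in H) weight_mx beta h *t rho h) k l
    = (\sum_(s in G) weight_mx alpha s *t ind_mx sigma rho s)
        (derived_index k) (derived_index l).
Proof.
case: (mxtens_indexP k) => p a; case: (mxtens_indexP l) => q b.
rewrite !derived_indexE voltage_sumE.
rewrite (voltage_sumE alpha (ind_mx_representation sHG sigma rho)) !enum_rankK.
case: (enum_val p) => u C; case: (enum_val q) => v D /=.
rewrite (@big_derived_edges _ u C) => [/=|eC /andP[/eqP]//].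
(* The sum over [X] also contains edges whose lift from [C] misses [D]; there the induced block
   vanishes, so the comparison is made edge by edge. *)
rewrite [LHS]big_mkcond [RHS]big_mkcond; apply: eq_bigr => e _.
rewrite !xpair_eqE eqxx andbT coset_shift_eq.
case: (org e == u); case: (tgt e == v) => //=.
rewrite ind_mxE ?voltG //; case: ifP => Hx; last by rewrite mulr0.
(* Here the lift ends over [D], so the derived voltage uses the representative of [D], as the block
   does. *)
by move: Hx; rewrite /derived_volt -coset_shift_eq => /eqP->.
Qed.

Lemma valency_derived (k l : 'I_(nZ * d)) :
  ((valency_mx Z - 1%:M) *t (1%:M : 'M_d)) k l
    = ((valency_mx X - 1%:M) *t 1%:M) (derived_index k) (derived_index l).
Proof.
case: (mxtens_indexP k) => p a; case: (mxtens_indexP l) => q b.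
rewrite valency_tensE -(bij_eq derived_index_bij) !derived_indexE.
rewrite valency_tensE !enum_rankK; congr ((_ - 1) *+ _); case: (enum_val p) => u C.
rewrite (@big_derived_edges _ u C) => [/=|eC /eqP//].
by apply: eq_bigl => e; rewrite xpair_eqE eqxx andbT.
Qed.

Lemma hpoly_derived :
  hpoly beta rho = hpoly alpha (ind_mx_representation sHG sigma rho).
Proof.
rewrite /hpoly -[RHS](det_mxsub_bij _ derived_index_bij); congr (\det _).
rewrite !tensmx1; apply/matrixP=> k l; rewrite !mxE (bij_eq derived_index_bij).
congr (_ - 'X * _%:P + _ * _%:P).
  exact: voltage_sum_derived.
by have := valency_derived k l; rewrite !mxE.
Qed.

End DerivedGraph.

Theorem mainTheorem14
  (K : fieldType) (Kbar : closedFieldType) (iota : {rmorphism K -> Kbar})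
  (Kbar_alg : forall z : Kbar, algebraicOver iota z)
  (X : wgraph iota) (gT : finGroupType) (G : {group gT})
  (alpha : voltage X G) (H : {group gT}) (sHG : H \subset G)
  (m : nat) (sigma : rcoset_reps G H m)
  (d : nat) (rho : mx_representation Kbar H d)
  (n : nat) (tau : mx_representation Kbar G n)
  (tau_ind : mx_rsim tau (ind_repr sHG rho)) :
  hpoly (derived_voltage alpha sigma) rho = hpoly alpha tau.
Proof.
(* [tau] is any matrix form of the induced representation, hence similar to the model. *)
rewrite (hpoly_derived sHG alpha sigma rho); apply/esym/hpoly_rsim.
exact: mx_rsim_trans tau_ind (mx_rsim_sym (ind_mx_rsim sHG sigma rho)).
Qed.
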